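(* There exists an irrational number $\alpha$ such that $\mathcal S(\alpha) = (-\infty, -\varepsilon] \cup [\varepsilon, +\infty)$, where $\varepsilon = \frac{\sqrt 2}{8}$.
   Context: For $\alpha\in\mathbb R$, $\mathcal S(\alpha)\subset\mathbb R$ denotes the set of all accumulation points of the set $\left\{ m^2\left(\frac{k}{m}-\alpha\right) : k,m\in\mathbb Z,\ m\neq 0\right\}$. The pairs $(k,m)$ are not required to be coprime. *)

(* Defs.v *)
From mathcomp Require Import all_boot all_order all_algebra.
From mathcomp Require Import all_classical all_reals all_analysis.
Import Order.TTheory GRing.Theory Num.Theory numFieldNormedType.Exports.

Set Implicit Arguments.
Unset Strict Implicit.
Unset Printing Implicit Defensive.

Local Open Scope classical_set_scope.
Local Open Scope ring_scope.

Definition scaled_errors (R : realType) (alpha : R) : set R :=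
  [set x : R | exists k m : int,
     m != 0 /\ x = m%:~R ^+ 2 * (k%:~R / m%:~R - alpha)].

Definition accS (R : realType) (alpha : R) : set R :=
  limit_point (scaled_errors alpha).

(* Main.v *)
(* Write alpha = [0; a_0, a_1, ...]. With T_n = [0; a_n, a_(n+1), ...] and
   v_n = [0; a_(n-1), ..., a_0], the n-th convergent p/q satisfies
   q (q alpha - p) = (-1)^n / (1 / T_n + v_n), where 1 / T_n + v_n = a_n + T_(n+1) + v_n.
   With digits in {1, 2, 3, 4} this denominator is at most 4 sqrt 2, the value for the
   periodic digits ..., 1, 4, 1, 4, 1, ..., so best approximation gives
   |m (k - m alpha)| >= sqrt 2 / 8 for all k and all nonzero m. Conversely, let every
   finite word over {1, 2, 3, 4} occur among the a_n. By Hall's theorem for these digits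
   the sums of two such continued fractions fill [sqrt 2 - 1, 4 sqrt 2 - 4], an interval
   of length more than 1, so the denominators come close to every point of
   [sqrt 2, 4 sqrt 2], for n of either parity. The multiples (r p, r q) then give values
   close to every point of +-[r^2 sqrt 2 / 8, r^2 sqrt 2 / 2], and these intervals cover
   everything beyond +-sqrt 2 / 8. *)

Require Import Defs.
From mathcomp Require Import all_boot all_order all_algebra.
From mathcomp Require Import all_classical all_reals all_analysis.
From mathcomp Require Import ring lra zify.
Import Order.TTheory GRing.Theory Num.Theory numFieldNormedType.Exports.

Local Open Scope classical_set_scope.
Local Open Scope ring_scope.

(** * Continued fractions with digits 1 to 4 as Moebius maps *)

(** [cf_min] is [0; 4, 1, 4, 1, ...] and [cf_max] is [0; 1, 4, 1, 4, ...], the extreme values for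
    digits 1 to 4. *)
Definition cf_min (R : rcfType) : R := (Num.sqrt 2 - 1) / 2.
Definition cf_max (R : rcfType) : R := 2 * Num.sqrt 2 - 2.

Definition in_cf_range {R : rcfType} (x : R) := cf_min R <= x <= cf_max R.

Definition cf_digit (a : nat) := (0 < a <= 4)%N.

Definition cf_eval {R : rcfType} (w : seq nat) (x : R) : R :=
  foldr (fun a y => (a%:R + y)^-1) x w.

Lemma sqrt2_sqr (R : rcfType) : Num.sqrt 2 * Num.sqrt 2 = 2 :> R.
Proof. by rewrite -expr2 sqr_sqrtr. Qed.

Lemma sqrt2_bounds (R : rcfType) : 1414 / 1000 < Num.sqrt (2 : R) < 1415 / 1000.
Proof.
have h := sqrt2_sqr R; have h0 : 0 <= Num.sqrt 2 :> R by rewrite sqrtr_ge0.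
by apply/andP; split; nra.
Qed.

Lemma cf_digit_le (R : rcfType) {a : nat} : cf_digit a -> 1 <= (a%:R : R) <= 4.
Proof. by case/andP=> a0 a4; rewrite ler1n a0 ler_nat. Qed.

Lemma cf_range_ge {R : rcfType} {x : R} : in_cf_range x -> 2 / 10 < x < 83 / 100.
Proof.
rewrite /in_cf_range /cf_min /cf_max => /andP[h1 h2].
by have /andP[r1 r2] := sqrt2_bounds R; apply/andP; split; lra.
Qed.

Lemma cf_range_step {R : rcfType} {a : nat} {x : R} :
  cf_digit a -> in_cf_range x -> in_cf_range (a%:R + x)^-1.
Proof.
move=> /(cf_digit_le R)/andP[a1 a4] xI.
have /andP[x1 x2] := cf_range_ge xI.
move: xI; rewrite /in_cf_range /cf_min /cf_max => /andP[h1 h2].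
have /andP[r1 r2] := sqrt2_bounds R; have r3 := sqrt2_sqr R.
have a0 : 0 < a%:R + x by lra.
by rewrite -[(a%:R + x)^-1]div1r ler_pdivlMr // ler_pdivrMr //; apply/andP; split; nra.
Qed.

(** [cf_eval w] is a Moebius map of determinant [s], and [q], [q'] are the last two convergent
    denominators of [w]. *)
Lemma cf_eval_sub {R : rcfType} {w : seq nat} : all cf_digit w ->
  exists s q q' : R, [/\ s = 1 \/ s = -1, 0 <= q', q' <= q, 0 < q &
    forall x y, 0 <= x -> 0 <= y ->
      cf_eval w x - cf_eval w y = s * ((x - y) / ((q + q' * x) * (q + q' * y)))].
Proof.
elim/last_ind: w => [_|w a IH].
  exists 1, 1, 0; split; rewrite ?ler01 ?ltr01 //; first by left.
  by move=> x y _ _; rewrite !mul0r !addr0 mulr1 divr1 mul1r.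
rewrite all_rcons => /andP[/(cf_digit_le R)/andP[a1 _] /IH].
move=> [s [q [q' [s1 q'0 q'q q0 E]]]].
exists (- s), (q * a%:R + q'), q; split; [|lra|nra|nra|].
  by case: s1 => ->; rewrite ?opprK; [right|left].
move=> x y x0 y0; rewrite /cf_eval -cats1 !foldr_cat /= -/(cf_eval _ _) -/(cf_eval _ _).
have ax : 0 < a%:R + x by lra.
have ay : 0 < a%:R + y by lra.
rewrite E ?invr_ge0 ?ltW //.
have qx : 0 < q * a%:R + q' + q * x by nra.
have qy : 0 < q * a%:R + q' + q * y by nra.
have qx' : 0 < (a%:R + x) * q + q' by nra.
have qy' : 0 < (a%:R + y) * q + q' by nra.
by field; rewrite !lt0r_neq0.
Qed.

Lemma cf_eval_rcons {R : rcfType} (w : seq nat) (a : nat) (x : R) :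
  cf_eval (rcons w a) x = cf_eval w (a%:R + x)^-1.
Proof. by rewrite /cf_eval -cats1 foldr_cat. Qed.

(** * Hall's bridges and the gaps between them *)

Definition bridge_end (R : rcfType) (j : nat) : R := (j%:R + cf_min R)^-1.

(** The hull of all continued fractions that begin with [w] and continue with a digit at least [j].
    The parity of the length of [w] decides which endpoint is the larger one. *)
Definition bridge_from {R : rcfType} (x y : R) :=
  exists w j, [/\ all cf_digit w, (0 < j < 4)%N,
    x = cf_eval w (cf_min R) & y = cf_eval w (bridge_end R j)].

Definition bridge {R : rcfType} (l h : R) := bridge_from l h \/ bridge_from h l.

Lemma invr_unique {R : fieldType} {x y : R} : x * y = 1 -> x^-1 = y.
Proof.
move=> xy; have x0 : x != 0.
  by apply/eqP => x0; move: xy; rewrite x0 mul0r => /eqP; rewrite eq_sym oner_eq0.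
by apply: (mulfI x0); rewrite xy divff.
Qed.

Lemma bridge_end1 (R : rcfType) : bridge_end R 1 = cf_max R.
Proof.
by apply: invr_unique; have := sqrt2_sqr R; rewrite /cf_min /cf_max; lra.
Qed.

Lemma cf_min_eq (R : rcfType) : (4 + cf_max R)^-1 = cf_min R.
Proof.
by apply: invr_unique; have := sqrt2_sqr R; rewrite /cf_min /cf_max; lra.
Qed.

(* [c, d] is the gap removed from the bridge [b, e]; the inequalities are affine in
   the distortion parameter of a Moebius image, hence only its extreme values 0
   and 1 occur. *)
Lemma bridge_gap (R : rcfType) (j : nat) : (0 < j < 4)%N ->
  let b := cf_min R in let c := bridge_end R j.+1 in
  let d := (j%:R + cf_max R)^-1 in let e := bridge_end R j in
  [/\ 0 <= b, b <= c, c <= d, d <= e &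
   [/\ (e - b) / 4 <= c - b, (e - b) / 4 <= e - d,
       (e - b) / 4 * (1 + d) <= (e - d) * (1 + b),
       d - c <= (e - b) / 4 & (d - c) * (1 + e) <= (e - b) / 4 * (1 + d)]].
Proof.
move=> j4; have /andP[r1 r2] := sqrt2_bounds R; have r3 := sqrt2_sqr R.
case: j j4 => [|[|[|[|j]]]] // _ b; rewrite /bridge_end; [set r := Num.sqrt 2 in r1 r2 r3..].
(* With the inverses rationalised, [r * r = 2] and the decimal bounds on [r] suffice. *)
- rewrite (@invr_unique _ (2 + _) ((6 - 2 * r) / 7)); last by rewrite /cf_min -/r; lra.
  rewrite (@invr_unique _ (1 + cf_max R) ((2 * r + 1) / 7)); last by rewrite /cf_max -/r; lra.
  rewrite (@invr_unique _ (1 + cf_min R) (2 * r - 2)); last by rewrite /cf_min -/r; lra.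
  by rewrite /b /cf_min -/r /=; split; [..|split]; lra.
- rewrite (@invr_unique _ (3 + _) ((10 - 2 * r) / 23)); last by rewrite /cf_min -/r; lra.
  rewrite (@invr_unique _ (2 + cf_max R) (r / 4)); last by rewrite /cf_max -/r; lra.
  rewrite (@invr_unique _ (2 + cf_min R) ((6 - 2 * r) / 7)); last by rewrite /cf_min -/r; lra.
  by rewrite /b /cf_min -/r /=; split; [..|split]; lra.
- rewrite (@invr_unique _ (4 + _) ((14 - 2 * r) / 47)); last by rewrite /cf_min -/r; lra.
  rewrite (@invr_unique _ (3 + cf_max R) ((2 * r - 1) / 7)); last by rewrite /cf_max -/r; lra.
  rewrite (@invr_unique _ (3 + cf_min R) ((10 - 2 * r) / 23)); last by rewrite /cf_min -/r; lra.
  by rewrite /b /cf_min -/r /=; split; [..|split]; lra.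
Qed.

(** [D x y] is the length of the image of [x, y] under a map with denominator [q + q' * x]. *)
Lemma moebius_gap {R : realFieldType} (q q' b c d e : R) :
  0 <= q' -> q' <= q -> 0 < q -> 0 <= b -> b <= c -> c <= d -> d <= e ->
  (e - b) / 4 <= c - b -> (e - b) / 4 <= e - d ->
  (e - b) / 4 * (1 + d) <= (e - d) * (1 + b) ->
  d - c <= (e - b) / 4 -> (d - c) * (1 + e) <= (e - b) / 4 * (1 + d) ->
  let D x y := (y - x) / ((q + q' * y) * (q + q' * x)) in
  [/\ D b e / 4 <= D b c, D b e / 4 <= D d e & D c d <= D b e / 4].
Proof.
move=> q'0 q'q q0 b0 bc cd de h1 h2 h3 h4 h5 D; rewrite /D.
have B0 : 0 < q + q' * b by nra.
have C0 : 0 < q + q' * c by nra.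
have D0 : 0 < q + q' * d by nra.
have E0 : 0 < q + q' * e by nra.
have -> : (e - b) / ((q + q' * e) * (q + q' * b)) / 4 =
   ((e - b) / 4) / ((q + q' * e) * (q + q' * b)) by rewrite mulrAC.
have key (x y A A' B B' : R) : 0 < A -> 0 < A' -> 0 < B -> 0 < B' ->
    x * (B * B') <= y * (A * A') -> x / (A * A') <= y / (B * B').
  move=> *; rewrite ler_pdivrMr ?mulr_gt0 // mulrAC ler_pdivlMr ?mulr_gt0 //.
split; apply: key => //.
- suff h : (e - b) / 4 * (q + q' * c) <= (c - b) * (q + q' * e).
    by rewrite !mulrA ler_pM2r.
  have : q' * c <= q' * e by apply: ler_wpM2l => //; lra.
  have : 0 <= (e - b) / 4 by lra.
  nra.
- suff h : (e - b) / 4 * (q + q' * d) <= (e - d) * (q + q' * b).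
    rewrite [X in X <= _](_ : _ = (q + q' * e) * ((e - b) / 4 * (q + q' * d))); last by ring.
    rewrite [X in _ <= X](_ : _ = (q + q' * e) * ((e - d) * (q + q' * b))); last by ring.
    by rewrite ler_pM2l.
  have := ler_wpM2l q'0 h3.
  have : 0 <= q - q' by lra.
  by move=> /ler_wpM2l /(_ _ _ h2); lra.
- suff h : (d - c) * (q + q' * e) <= (e - b) / 4 * (q + q' * d).
    have h6 : (q + q' * b) * ((d - c) * (q + q' * e)) <=
              (q + q' * c) * ((e - b) / 4 * (q + q' * d)).
      apply: ler_pM => //; [exact: ltW| |nra].
      by apply: mulr_ge0; [lra|exact: ltW].
    lra.
  have := ler_wpM2l q'0 h5.
  have : 0 <= q - q' by lra.
  by move=> /ler_wpM2l /(_ _ _ h4); lra.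
Qed.

(** The removed gap separates next digit [j] from next digits above [j]: [c] and [d] are its images
    under [w]. *)
Lemma bridge_from_split {R : rcfType} {x y : R} : bridge_from x y ->
  exists c d s, [/\ bridge x c, bridge d y, s = 1 \/ s = -1 &
    [/\ s * (y - x) / 4 <= s * (c - x), s * (y - x) / 4 <= s * (y - d),
        s * (d - c) <= s * (y - x) / 4, 0 <= s * (d - c) & 0 <= s * (y - x)]].
Proof.
move=> [w [j [w4 j4 -> ->]]].
have [s [q [q' [s1 q'0 q'q q0 E]]]] := @cf_eval_sub R w w4.
have [b0 bc cd de [h1 h2 h3 h4 h5]] := bridge_gap R j j4.
set b := cf_min R in b0 bc h1 h2 h3 h4 h5 *.
set c := bridge_end R j.+1 in bc cd h1 h4 h5.
set d := (j%:R + cf_max R)^-1 in cd de h2 h3 h4 h5.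
set e := bridge_end R j in de h1 h2 h3 h4 h5 *.
have [k1 k2 k3] := moebius_gap q q' b c d e q'0 q'q q0 b0 bc cd de h1 h2 h3 h4 h5.
have sE (u v : R) : 0 <= u -> 0 <= v ->
    s * (cf_eval w u - cf_eval w v) = (u - v) / ((q + q' * u) * (q + q' * v)).
  by move=> u0 v0; rewrite E // mulrA; case: s1 => ->; rewrite ?mulrNN !mul1r.
have [j0 jlt4] := andP j4.
have j4' : cf_digit j by rewrite /cf_digit j0 ltnW.
exists (cf_eval w c), (cf_eval w d), s; split => //.
(* For [j = 3] only the digit 4 is left; it is absorbed into the word and all next digits become
   free. *)
- have [j3|j3] := ltnP j 3; first by left; exists w, j.+1.
  have -> : c = (4%:R + cf_min R)^-1.
    by rewrite /c /bridge_end (_ : j = 3) //; apply/eqP; rewrite eqn_leq j3 andbT.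
  rewrite -cf_eval_rcons; right; exists (rcons w 4), 1; split => //.
    by rewrite all_rcons w4.
  by rewrite cf_eval_rcons bridge_end1 cf_min_eq.
- right; exists (rcons w j), 1; split => //; first by rewrite all_rcons w4 j4'.
    by rewrite cf_eval_rcons.
  by rewrite bridge_end1 cf_eval_rcons.
- rewrite !sE //; try lra; split => //.
  - by apply: divr_ge0; [lra|apply: mulr_ge0; apply: addr_ge0; try (exact: ltW);
      apply: mulr_ge0; lra].
  - by apply: divr_ge0; [lra|apply: mulr_ge0; apply: addr_ge0; try (exact: ltW);
      apply: mulr_ge0; lra].
Qed.

Lemma bridge_split {R : rcfType} {l h : R} : bridge l h -> l < h ->
  exists c d, [/\ bridge l c, bridge d h &
    [/\ c <= d, (h - l) / 4 <= c - l, (h - l) / 4 <= h - d & d - c <= (h - l) / 4]].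
Proof.
have bS (x y : R) : bridge x y -> bridge y x by move=> [?|?]; [right|left].
move=> [] /bridge_from_split [c [d [s [bc bd [->|->] [h1 h2 h3 h4 h5]]]]] lh; try lra.
  by exists c, d; split => //; split; lra.
by exists d, c; split; [exact: bS|exact: bS|split; lra].
Qed.

(** A next digit 4 is always allowed in a bridge, so appending 4 to its word gives a cylinder inside
    it. *)
Lemma bridge_eval {R : rcfType} {l h : R} : bridge l h -> l <= h ->
  exists2 w, all cf_digit w & forall z, in_cf_range z -> l <= cf_eval w z <= h.
Proof.
suff H (x y : R) : bridge_from x y -> exists s w, [/\ s = 1 \/ s = -1, all cf_digit w &
    forall z, in_cf_range z -> [/\ 0 <= s * (cf_eval w z - x) & 0 <= s * (y - cf_eval w z)]].
  move=> [] /H [s [w [[->|->] w4 wz]]] lh; exists w => // z /wz[]; lra.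
move=> [w [j [w4 j4 -> ->]]].
have [s [q [q' [s1 q'0 q'q q0 E]]]] := @cf_eval_sub R w w4.
have sE (u v : R) : 0 <= u -> 0 <= v ->
    s * (cf_eval w u - cf_eval w v) = (u - v) / ((q + q' * u) * (q + q' * v)).
  by move=> u0 v0; rewrite E // mulrA; case: s1 => ->; rewrite ?mulrNN !mul1r.
have s0 : 0 <= cf_min R.
  by have /andP[? _] := sqrt2_bounds R; rewrite /cf_min; lra.
exists s, (rcons w 4); split => //; first by rewrite all_rcons w4.
move=> z zI; rewrite cf_eval_rcons.
have /andP[z1 z2] : in_cf_range (4 + z)^-1 by apply: cf_range_step.
have z0 : 0 <= (4 + z)^-1 by lra.
have e0 : 0 <= bridge_end R j by rewrite invr_ge0 addr_ge0.
have ze : (4 + z)^-1 <= bridge_end R j.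
  have j0 : (0 : R) < j%:R by rewrite ltr0n; case/andP: j4.
  have j4' : j%:R <= 4 :> R by rewrite ler_nat ltnW //; case/andP: j4.
  have /andP[z3 _] := zI.
  by rewrite /bridge_end lef_pV2 ?posrE; lra.
by rewrite !sE //; split; (apply: divr_ge0; [lra|];
  by apply: mulr_ge0; apply: addr_ge0; try (exact: ltW); apply: mulr_ge0).
Qed.

Lemma bridge_full (R : rcfType) : bridge (cf_min R) (cf_max R).
Proof. by left; exists [::], 1; rewrite bridge_end1. Qed.

(* Always splitting the longer interval keeps the length ratio in [1/4, 4], so that
   the gap is never longer than the other interval. *)
Lemma bridge_sum {R : rcfType} {tau : R} (n : nat) :
  2 * cf_min R <= tau <= 2 * cf_max R ->
  exists l1 h1 l2 h2, [/\ bridge l1 h1, bridge l2 h2, l1 < h1, l2 < h2 &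
    [/\ l1 + l2 <= tau <= h1 + h2, (h1 - l1) <= 4 * (h2 - l2),
        (h2 - l2) <= 4 * (h1 - l1) & (h1 - l1) + (h2 - l2) <= 2 * (7 / 8) ^+ n]].
Proof.
move=> tauI; elim: n => [|n [l1 [h1 [l2 [h2 [b1 b2 lh1 lh2 [t r1 r2 H]]]]]]].
  have /andP[? ?] := sqrt2_bounds R.
  have b := bridge_full R; exists (cf_min R), (cf_max R), (cf_min R), (cf_max R).
  move: tauI b; rewrite expr0 /cf_min /cf_max => /andP[? ?] b.
  by split; [..|split] => //; try apply/andP; try split; lra.
wlog len : l1 h1 l2 h2 b1 b2 lh1 lh2 t r1 r2 H / (h2 - l2) <= (h1 - l1).
  move=> W; have [len|/ltW len] := leP (h2 - l2) (h1 - l1); first exact: (W l1 h1 l2 h2).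
  have [||l1' [h1' [l2' [h2' [b1' b2' lh1' lh2' [t' r1' r2' H']]]]]] :=
    W l2 h2 l1 h1 b2 b1 lh2 lh1 _ r2 r1 _ len; rewrite 1?addrC //.
    by rewrite (addrC h2).
  exists l2', h2', l1', h1'; split=> //; split => //; rewrite 1?addrC //.
  by rewrite (addrC h2').
have [c [d [bc bd [k0 k1 k2 k3]]]] := bridge_split b1 lh1.
move: t => /andP[t1 t2]; rewrite exprS.
(* The gap is at most [h2 - l2], so [d + l2 <= c + h2] and one of the two choices keeps [tau]. A
   quarter of the longer interval goes, hence at least an eighth of the total. *)
have [tc|tc] := leP tau (c + h2).
  exists l1, c, l2, h2; split => //; first lra.
  by split; [apply/andP; split; lra|lra|lra|lra].
exists d, h1, l2, h2; split => //; first lra.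
by split; [apply/andP; split; lra|lra|lra|lra].
Qed.

(* Hall's theorem for the digits 1, ..., 4, in finitary form. *)
Lemma cf_eval_sum_dense {R : realType} {tau delta : R} :
  2 * cf_min R <= tau <= 2 * cf_max R -> 0 < delta ->
  exists w1 w2, [/\ all cf_digit w1, all cf_digit w2 &
    forall z1 z2, in_cf_range z1 -> in_cf_range z2 ->
      `|cf_eval w1 z1 + cf_eval w2 z2 - tau| <= delta].
Proof.
move=> tauI delta0.
have [n Hn] : exists n, 2 * (7 / 8) ^+ n <= delta.
  have : (fun n => (7 / 8 : R) ^+ n) @ \oo --> 0.
    by apply: cvg_expr; rewrite ger0_norm; lra.
  move=> /cvgrPdist_le /(_ (delta / 2) (divr_gt0 delta0 (ltr0Sn _ _))) [n _ /(_ n (leqnn n))] /=.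
  rewrite sub0r normrN ger0_norm ?exprn_ge0 ?divr_ge0 //.
  by exists n; lra.
have [l1 [h1 [l2 [h2 [b1 b2 lh1 lh2 [/andP[t1 t2] r1 r2 H]]]]]] := bridge_sum n tauI.
have [w1 w14 H1] := bridge_eval b1 (ltW lh1).
have [w2 w24 H2] := bridge_eval b2 (ltW lh2).
exists w1, w2; split => // z1 z2 /H1/andP[? ?] /H2/andP[? ?].
by rewrite ler_norml; apply/andP; split; lra.
Qed.

(** * A digit sequence containing every finite word *)

Definition digit_word (n : nat) : seq nat :=
  if unpickle n is Some w then if all cf_digit w then w else [::] else [::].

(* Starting with the digit 2 puts the second value of [cf_rev] below into the range
   [cf_min, cf_max], where all later ones then stay. *)
Fixpoint universal_prefix (n : nat) : seq nat :=
  if n is m.+1 then universal_prefix m ++ 1 :: digit_word m else [:: 2].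

Definition universal_digit (n : nat) : nat := nth 2 (universal_prefix n) n.

Lemma digit_word_digits (n : nat) : all cf_digit (digit_word n).
Proof. by rewrite /digit_word; case: unpickle => // w; case: ifP. Qed.

Lemma universal_prefix_digits (n : nat) : all cf_digit (universal_prefix n).
Proof. by elim: n => //= n IH; rewrite all_cat IH /= digit_word_digits. Qed.

Lemma universal_prefix_size (n : nat) : (n < size (universal_prefix n))%N.
Proof.
elim: n => //= n IH; rewrite size_cat /= addnS ltnS.
exact: leq_trans IH (leq_addr _ _).
Qed.

Lemma universal_prefix_cat (m n : nat) : (m <= n)%N ->
  exists w, universal_prefix n = universal_prefix m ++ w.
Proof.
elim: n => [|n IH]; first by rewrite leqn0 => /eqP ->; exists [::]; rewrite cats0.
rewrite leq_eqVlt => /orP[/eqP ->|/IH [w /= ->]]; first by exists [::]; rewrite cats0.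
by exists (w ++ 1 :: digit_word n); rewrite catA.
Qed.

Lemma universal_digit_nth (m i : nat) : (i < size (universal_prefix m))%N ->
  universal_digit i = nth 2 (universal_prefix m) i.
Proof.
move=> im; rewrite /universal_digit; have [le_mi|/ltnW le_im] := leqP m i.
  by have [w ->] := universal_prefix_cat m i le_mi; rewrite nth_cat im.
have [w ->] := universal_prefix_cat i m le_im.
by rewrite nth_cat universal_prefix_size.
Qed.

Lemma universal_digit_digit (n : nat) : cf_digit (universal_digit n).
Proof.
by apply: (allP (universal_prefix_digits n)); rewrite mem_nth ?universal_prefix_size.
Qed.

Lemma universal_digit_word {w : seq nat} : all cf_digit w ->
  exists2 i, (0 < i)%N & forall j, (j < size w)%N -> universal_digit (i + j) = nth 0 w j.
Proof.
move=> w4; set n := pickle w.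
have wE : digit_word n = w by rewrite /digit_word pickleK w4.
have E : universal_prefix n.+1 = universal_prefix n ++ 1 :: w by rewrite /= wE.
exists (size (universal_prefix n)).+1 => // j jw.
rewrite (universal_digit_nth n.+1) E.
  by rewrite nth_cat addSn -addnS ltnNge leq_addr /= addKn /= (set_nth_default 0).
by rewrite size_cat /= addSn -addnS ltn_add2l.
Qed.

(* A repeated word of odd length occurs at positions of both parities. *)
Lemma universal_digit_word_parity {w : seq nat} (b : bool) : all cf_digit w ->
  exists i, [/\ (0 < i)%N, odd i = b &
    forall j, (j < size w)%N -> universal_digit (i + j) = nth 0 w j].
Proof.
move=> w4; pose v := if odd (size w) then w else rcons w 1.
have [v4 vo vs vw] : [/\ all cf_digit v, odd (size v), (size w <= size v)%N &
    forall j, (j < size w)%N -> nth 0 v j = nth 0 w j].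
  rewrite /v; case: ifPn => // wo; rewrite all_rcons w4 size_rcons /= wo; split => //.
  by move=> j jw; rewrite nth_rcons jw.
have [|i i0 iE] := @universal_digit_word (v ++ v); first by rewrite all_cat v4.
have [ib|ib] := eqVneq (odd i) b.
  exists i; split => // j jw; have jv := leq_trans jw vs.
  by rewrite iE ?nth_cat ?jv ?vw // size_cat ltn_addr.
exists (i + size v)%N; split.
- by rewrite addn_gt0 i0.
- by rewrite oddD vo addbT; move: ib; case: (odd i); case: b.
- move=> j jw; have jv := leq_trans jw vs; rewrite -addnA iE; last first.
    by rewrite size_cat ltn_add2l.
  by rewrite nth_cat ltnNge leq_addr /= addKn vw.
Qed.

(** * Infinite continued fractions as limits *)

(** Ending in [cf_min] instead of 0 keeps every truncation in the range. *)
Fixpoint cf_trunc {R : rcfType} (a : nat -> nat) (k n : nat) : R :=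
  if k is k'.+1 then ((a n)%:R + cf_trunc a k' n.+1)^-1 else cf_min R.

Lemma cf_min_range (R : rcfType) : in_cf_range (cf_min R).
Proof.
by have /andP[? ?] := sqrt2_bounds R; rewrite /in_cf_range /cf_min /cf_max;
  apply/andP; split; lra.
Qed.

Lemma cf_trunc_range {R : rcfType} {a : nat -> nat} (k n : nat) :
  (forall i, cf_digit (a i)) -> in_cf_range (cf_trunc a k n : R).
Proof.
move=> a4; elim: k n => [|k IH] n /=; first exact: cf_min_range.
exact: cf_range_step.
Qed.

(** Tails exceed 2/10, so each digit contracts distances by at least 1/1.44 < 7/10. *)
Lemma cf_trunc_cauchy {R : rcfType} {a : nat -> nat} (k n : nat) :
  (forall i, cf_digit (a i)) ->
  `|cf_trunc a k.+1 n - cf_trunc a k n : R| <= (7 / 10) ^+ k.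
Proof.
move=> a4; elim: k n => [|k IH] n.
  have /cf_range_ge/andP[? ?] := @cf_trunc_range R a 1 n a4.
  have /cf_range_ge/andP[? ?] := @cf_trunc_range R a 0 n a4.
  by rewrite expr0 ler_norml; apply/andP; split; lra.
have /cf_range_ge/andP[u0 u1] := @cf_trunc_range R a k.+1 n.+1 a4.
have /cf_range_ge/andP[v0 v1] := @cf_trunc_range R a k n.+1 a4.
have := IH n.+1; rewrite [cf_trunc a k.+2 n]/= [cf_trunc a k.+1 n]/=.
rewrite -/(cf_trunc a k.+1 n.+1).
have /andP[a1 _] := cf_digit_le R (a4 n).
move: (cf_trunc a k.+1 n.+1 : R) (cf_trunc a k n.+1 : R) ((a n)%:R : R) u0 u1 v0 v1 a1.
move=> u v A u0 u1 v0 v1 a1 uv.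
have Au : 0 < A + u by lra.
have Av : 0 < A + v by lra.
have -> : (A + u)^-1 - (A + v)^-1 = (v - u) / ((A + u) * (A + v)).
  by field; rewrite !lt0r_neq0.
rewrite normrM normfV (ger0_norm (ltW (mulr_gt0 Au Av))) ler_pdivrMr ?mulr_gt0 //.
rewrite distrC exprS; apply: le_trans uv _; rewrite mulrAC ler_peMl ?exprn_ge0 ?divr_ge0 //.
nra.
Qed.

Lemma cf_tails_exist (R : realType) {a : nat -> nat} : (forall i, cf_digit (a i)) ->
  exists T : nat -> R, forall n,
    in_cf_range (T n) /\ T n = ((a n)%:R + T n.+1)^-1.
Proof.
move=> a4; pose y n k : R := cf_trunc a k n.
have cvgy n : cvgn (y n).
  have : cvgn (series (fun k => y n k.+1 - y n k)).
    apply: normed_cvg; apply: (@series_le_cvg _ _ (geometric 1 (7 / 10))) => [k|k|k|].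
    - exact: normr_ge0.
    - by rewrite /= mul1r exprn_ge0 // divr_ge0.
    - by rewrite /= mul1r; exact: cf_trunc_cauchy.
    - by apply: is_cvg_geometric_series; rewrite ger0_norm; lra.
  move=> cs; have -> : y n = (fun k => y n 0 + series (fun k => y n k.+1 - y n k) k).
    by apply/funext => k; rewrite /series /= telescope_sumr // addrC subrK.
  by apply: is_cvgD => //; exact: is_cvg_cst.
have yI n k : in_cf_range (y n k) by exact: cf_trunc_range.
pose T n := limn (y n).
have TI n : in_cf_range (T n).
  apply/andP; split.
    by apply: limr_ge => //; near=> k; have /andP[] := yI n k.
  by apply: limr_le => //; near=> k; have /andP[] := yI n k.
exists T => n; split => //.
apply/cvg_lim => //; rewrite -cvg_shiftS.
apply: cvgV; last by apply: cvgD; [exact: cvg_cst|exact: cvgy].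
have /cf_range_ge/andP[? ?] := TI n.+1; have /andP[a1 _] := cf_digit_le R (a4 n).
by rewrite lt0r_neq0 //; lra.
Unshelve. all: by end_near.
Qed.

(** * Convergents, their errors and best approximation *)

(* Shifted by one with respect to the usual convention: [cf_num a n.+1] and
   [cf_den a n.+1] are the numerator and denominator of [0; a 0, ..., a n.-1]. *)
Fixpoint cf_rec (a : nat -> nat) (x y : int) (n : nat) : int :=
  if n is n'.+1 then
    if n' is m.+1 then (a m)%:Z * cf_rec a x y n' + cf_rec a x y m else y
  else x.

Definition cf_num (a : nat -> nat) := cf_rec a 1 0.
Definition cf_den (a : nat -> nat) := cf_rec a 0 1.

Lemma cf_numS (a : nat -> nat) (n : nat) :
  cf_num a n.+2 = (a n)%:Z * cf_num a n.+1 + cf_num a n.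
Proof. by []. Qed.

Lemma cf_denS (a : nat -> nat) (n : nat) :
  cf_den a n.+2 = (a n)%:Z * cf_den a n.+1 + cf_den a n.
Proof. by []. Qed.

Lemma cf_den_det (a : nat -> nat) (n : nat) :
  cf_den a n.+1 * cf_num a n - cf_den a n * cf_num a n.+1 = (-1) ^+ n.
Proof.
elim: n => [|n IH]; first by rewrite expr0.
by rewrite exprS -IH cf_numS cf_denS; ring.
Qed.

(** The denominators start 0, 1, [a 0]; a first digit above 1 makes them strictly increasing from
    the outset. *)
Lemma cf_den_growth {a : nat -> nat} (n : nat) :
  (forall i, cf_digit (a i)) -> (1 < a 0)%N ->
  n%:Z <= cf_den a n /\ cf_den a n < cf_den a n.+1.
Proof.
move=> a4 a0; suff [] : (n%:Z <= cf_den a n /\ cf_den a n < cf_den a n.+1) /\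
    cf_den a n.+1 < cf_den a n.+2 by [].
elim: n => [|n [[h1 h2] h3]]; first by rewrite /cf_den /= mulr1 addr0.
have h : n.+1%:Z <= cf_den a n.+1 by lia.
split=> //; rewrite (cf_denS a n.+1).
have a1 : 1 <= (a n.+1)%:Z by have /andP[] := a4 n.+1.
have : cf_den a n.+2 <= (a n.+1)%:Z * cf_den a n.+2 by rewrite ler_peMl //; lia.
by lia.
Qed.

Lemma cf_den_gt0 {a : nat -> nat} (n : nat) :
  (forall i, cf_digit (a i)) -> (1 < a 0)%N -> 0 < cf_den a n.+1.
Proof. by move=> a4 a0; have [h _] := cf_den_growth n.+1 a4 a0; lia. Qed.

(** This is v_n = [0; a (n-1), ..., a 0], with value 0 at [n = 0]. *)
Definition cf_rev (R : rcfType) (a : nat -> nat) (n : nat) : R :=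
  (cf_den a n)%:~R / (cf_den a n.+1)%:~R.

Lemma cf_revS {R : rcfType} {a : nat -> nat} (n : nat) :
  (forall i, cf_digit (a i)) -> (1 < a 0)%N ->
  cf_rev R a n.+1 = ((a n)%:R + cf_rev R a n)^-1.
Proof.
move=> a4 a0; have := cf_den_gt0 n a4 a0; rewrite -(ltr0z R) => /lt0r_neq0 q0.
rewrite /cf_rev cf_denS rmorphD rmorphM /= -pmulrn -invf_div.
by rewrite mulrDl mulfK.
Qed.

Lemma cf_rev_range {R : rcfType} {a : nat -> nat} (n : nat) :
  (forall i, cf_digit (a i)) -> (1 < a 0)%N -> in_cf_range (cf_rev R a n.+1).
Proof.
move=> a4 a0; elim: n => [|n IH]; rewrite cf_revS //; last exact: cf_range_step.
have /andP[_ a04] := a4 0.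
have x2 : (2 : R) <= (a 0)%:R by rewrite ler_nat.
have x4 : (a 0)%:R <= 4 :> R by rewrite ler_nat.
rewrite /cf_rev mul0r addr0 /in_cf_range /cf_min /cf_max.
have /andP[r1 r2] := sqrt2_bounds R.
have x0 : 0 < (a 0)%:R :> R by lra.
rewrite -[(a 0)%:R^-1]div1r ler_pdivlMr // ler_pdivrMr //.
by apply/andP; split; nra.
Qed.

Lemma cf_eval_tail {R : rcfType} {a : nat -> nat} {T : nat -> R} {w : seq nat} {n : nat} :
  (forall i, T i = ((a i)%:R + T i.+1)^-1) ->
  (forall j, (j < size w)%N -> a (n + j)%N = nth 0 w j) ->
  T n = cf_eval w (T (n + size w)%N).
Proof.
move=> TE; elim: w n => [|c w IH] n aw /=; first by rewrite addn0.
rewrite TE (IH n.+1); last by move=> j jw; rewrite addSnnS aw.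
by have := aw 0 isT; rewrite addn0 addSnnS /= => ->.
Qed.

Lemma cf_eval_rev {R : rcfType} {a : nat -> nat} {w : seq nat} {n : nat} :
  (forall i, cf_digit (a i)) -> (1 < a 0)%N ->
  (forall j, (j < size w)%N -> a (n + j)%N = nth 0 (rev w) j) ->
  cf_rev R a (n + size w) = cf_eval w (cf_rev R a n).
Proof.
move=> a4 a0; elim: w => [|c w IH] aw /=; first by rewrite addn0.
rewrite addnS cf_revS // IH; last first.
  by move=> j jw; rewrite aw ?ltnS 1?ltnW // rev_cons nth_rcons size_rev jw.
by rewrite aw //= rev_cons nth_rcons size_rev ltnn eqxx.
Qed.

Definition cf_error {R : rcfType} (a : nat -> nat) (alpha : R) (n : nat) : R :=
  (cf_den a n)%:~R * alpha - (cf_num a n)%:~R.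

(** Errors obey the recurrence of the convergents, and [a n + T n.+1 = (T n)^-1] carries the ratio
    to the next index. *)
Lemma cf_errorS {R : rcfType} {a : nat -> nat} {T : nat -> R} (n : nat) :
  (forall i, T i = ((a i)%:R + T i.+1)^-1) -> (forall i, 0 < T i) ->
  cf_error a (T 0) n.+1 = - T n * cf_error a (T 0) n.
Proof.
move=> TE T0; elim: n => [|n IH].
  by rewrite /cf_error /cf_den /cf_num /=; ring.
have -> : cf_error a (T 0) n.+2 = (a n)%:R * cf_error a (T 0) n.+1 + cf_error a (T 0) n.
  by rewrite /cf_error cf_denS cf_numS !rmorphD !rmorphM /= -!pmulrn; ring.
have Tn : (a n)%:R + T n.+1 = (T n)^-1 by rewrite (TE n) invrK.
have -> : cf_error a (T 0) n = - (T n)^-1 * cf_error a (T 0) n.+1.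
  by rewrite IH mulrA mulrNN mulVf ?mul1r // lt0r_neq0.
by rewrite -Tn; ring.
Qed.

(** Replacing numerators by errors in the determinant identity, and error [n] by [- (T n)^-1] times
    error [n.+1], leaves one equation for error [n.+1]. *)
Lemma cf_error_value {R : rcfType} {a : nat -> nat} {T : nat -> R} (n : nat) :
  (forall i, cf_digit (a i)) -> (1 < a 0)%N ->
  (forall i, T i = ((a i)%:R + T i.+1)^-1) -> (forall i, 0 < T i) ->
  (cf_den a n.+1)%:~R * cf_error a (T 0) n.+1 = (-1) ^+ n / ((T n)^-1 + cf_rev R a n).
Proof.
move=> a4 a0 TE T0.
have q1 : 0 < (cf_den a n.+1)%:~R :> R by rewrite ltr0z cf_den_gt0.
have q0 : 0 <= (cf_den a n)%:~R :> R.
  by have [h _] := cf_den_growth n a4 a0; rewrite ler0z; apply: le_trans h.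
have det : (cf_den a n.+1)%:~R * (cf_num a n)%:~R -
    (cf_den a n)%:~R * (cf_num a n.+1)%:~R = (-1) ^+ n :> R.
  by rewrite -!rmorphM -rmorphB cf_den_det rmorphXn rmorphN1.
have Tn0 := T0 n.
have E := cf_errorS n TE T0.
have l0 : 0 < (T n)^-1 + cf_rev R a n.
  by rewrite ltr_pwDl ?invr_gt0 // divr_ge0 // ltW.
apply: (canRL (mulfK (lt0r_neq0 l0))); rewrite -det /cf_rev.
have D0 : cf_error a (T 0) n = - (T n)^-1 * cf_error a (T 0) n.+1.
  by rewrite E mulrA mulrNN mulVf ?mul1r // lt0r_neq0.
have -> : (cf_num a n)%:~R = (cf_den a n)%:~R * T 0 - cf_error a (T 0) n by rewrite /cf_error; ring.
rewrite D0 {2}/cf_error.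
have -> : (cf_num a n.+1)%:~R = (cf_den a n.+1)%:~R * T 0 - cf_error a (T 0) n.+1.
  by rewrite /cf_error; ring.
by field; rewrite !lt0r_neq0.
Qed.

(** Lagrange's argument: [(m, k)] is an integer combination of two consecutive convergents whose
    errors cannot cancel. *)
Lemma cf_error_best {R : rcfType} {a : nat -> nat} {T : nat -> R} (k m : int) :
  (forall i, cf_digit (a i)) -> (1 < a 0)%N ->
  (forall i, T i = ((a i)%:R + T i.+1)^-1) -> (forall i, 0 < T i <= 1) -> m != 0 ->
  exists n, `|(cf_den a n.+1)%:~R * cf_error a (T 0) n.+1| <=
    `|m%:~R * (m%:~R * T 0 - k%:~R)|.
Proof.
move=> a4 a0 TE T01 m0.
have T0 i : 0 < T i by have /andP[] := T01 i.
have : exists N, `|m| < cf_den a N.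
  by exists `|m|.+1; have [h _] := cf_den_growth `|m|.+1 a4 a0; lia.
move=> /ex_minnP [N mN Nmin].
case: N mN Nmin => [|[|n]] mN Nmin.
- by move: mN; rewrite /cf_den /=; lia.
- by move: mN m0; rewrite /cf_den /=; lia.
exists n.
have mn : cf_den a n.+1 <= `|m| by rewrite leNgt; apply/negP => /Nmin; rewrite ltnn.
have det := cf_den_det a n.+1.
have q1 := cf_den_gt0 n a4 a0.
have q2 := cf_den_gt0 n.+1 a4 a0.
set e : int := (-1) ^+ n.+1 in det.
have ee : e * (cf_den a n.+2 * cf_num a n.+1 - cf_den a n.+1 * cf_num a n.+2) = 1.
  by rewrite det -expr2 sqrr_sign.
(* Cramer's rule for the unimodular system [mE], [kE]. *)
pose x : int := e * (k * cf_den a n.+2 - m * cf_num a n.+2).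
pose y : int := e * (m * cf_num a n.+1 - k * cf_den a n.+1).
have mE : m = x * cf_den a n.+1 + y * cf_den a n.+2.
  by rewrite -[LHS]mul1r -ee /x /y; ring.
have kE : k = x * cf_num a n.+1 + y * cf_num a n.+2.
  by rewrite -[LHS]mul1r -ee /x /y; ring.
move: x y mE kE => x y mE kE.
(* Coefficients of equal sign, or [x = 0], would contradict [|m| < cf_den a n.+2]. *)
have xy : (0 < x /\ y <= 0) \/ (x < 0 /\ 0 <= y).
  move: x y mE {kE} => x y mE; rewrite {}mE in mN m0.
  move: (cf_den a n.+1) (cf_den a n.+2) q1 q2 mN m0 => u v u0 v0 xy_v xy0.
  have [x0|x0|x0] := ltgtP x 0.
  - right; split => //; rewrite leNgt; apply/negP => y0.
    by move: xy_v; rewrite ltNge => /negP; apply; nia.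
  - left; split => //; rewrite leNgt; apply/negP => y0.
    by move: xy_v; rewrite ltNge => /negP; apply; nia.
  - move: xy_v xy0; rewrite x0 mul0r add0r; have [->|y0] := eqVneq y 0.
      by rewrite mul0r.
    by rewrite normrM (gtr0_norm v0) gtr_pMl // => /ltac:(lia).
have -> : m%:~R * T 0 - k%:~R = cf_error a (T 0) n.+1 * (x%:~R - T n.+1 * y%:~R).
  rewrite {1}mE {1}kE.
  have -> : cf_error a (T 0) n.+1 * (x%:~R - T n.+1 * y%:~R) =
    x%:~R * cf_error a (T 0) n.+1 + y%:~R * cf_error a (T 0) n.+2.
    rewrite (cf_errorS n.+1 TE T0).
    by move: (cf_error a (T 0) n.+1) (T n.+1) (x%:~R : R) (y%:~R : R) => D t u v; ring.
  rewrite /cf_error.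
  move: (cf_den a n.+1) (cf_den a n.+2) (cf_num a n.+1) (cf_num a n.+2) => q q' p p'.
  by rewrite !intrD !intrM; ring.
rewrite mulrA !normrM -mulrA; apply: ler_pM => //.
  by rewrite -!intr_norm ler_int gtr0_norm.
rewrite ler_peMr //.
have /andP[t0 t1] := T01 n.+1.
case: xy => -[x0 y0].
  have x1 : (1 : R) <= x%:~R by rewrite ler1z; lia.
  have y1 : y%:~R <= 0 :> R by rewrite lerz0.
  by rewrite ger0_norm; nra.
have x1 : x%:~R <= -1 :> R by rewrite -[-1]/((-1)%:~R) ler_int; lia.
have y1 : 0 <= y%:~R :> R by rewrite ler0z.
by rewrite ler0_norm; nra.
Qed.

(** * Range and density of the denominators 1 / T_n + v_n *)

(** The denominator is [a n + T n.+1 + cf_rev R a n], at most [4 + 2 * cf_max]. *)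
Lemma cf_value_range {R : realType} {a : nat -> nat} {T : nat -> R} (n : nat) :
  (forall i, cf_digit (a i)) -> (1 < a 0)%N ->
  (forall i, in_cf_range (T i) /\ T i = ((a i)%:R + T i.+1)^-1) ->
  1 <= (T n)^-1 + cf_rev R a n <= 4 * Num.sqrt 2.
Proof.
move=> a4 a0 HT; have [TI TE] := HT n; have [TI' _] := HT n.+1.
have /andP[a1 a4'] := cf_digit_le R (a4 n).
have /andP[r1 r2] := sqrt2_bounds R.
have /andP[v0 v1] : 0 <= cf_rev R a n <= cf_max R.
  case: n {TI TE TI' a1 a4'} => [|n].
    by rewrite /cf_rev mul0r /cf_max; apply/andP; split; lra.
  have vI := @cf_rev_range R a n a4 a0; have /andP[? _] := cf_range_ge vI.
  by have /andP[_ ->] := vI; rewrite andbT; apply: ltW; apply: lt_trans; last eassumption; lra.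
have /andP[t0 _] := cf_range_ge TI'; have /andP[_ t1] := TI'.
by rewrite TE invrK; move: v1 t1; rewrite /cf_max => v1 t1; apply/andP; split; lra.
Qed.

Lemma cf_value_dense {R : realType} {a : nat -> nat} {T : nat -> R} {lambda delta : R} (b : bool) :
  (forall i, cf_digit (a i)) -> (1 < a 0)%N ->
  (forall w b, all cf_digit w -> exists i, [/\ (0 < i)%N, odd i = b &
    forall j, (j < size w)%N -> a (i + j)%N = nth 0 w j]) ->
  (forall i, in_cf_range (T i) /\ T i = ((a i)%:R + T i.+1)^-1) ->
  Num.sqrt 2 <= lambda <= 4 * Num.sqrt 2 -> 0 < delta ->
  exists n, odd n = b /\ `|(T n)^-1 + cf_rev R a n - lambda| <= delta.
Proof.
move=> a4 a0 aw HT /andP[l1 l2] delta0; have /andP[r1 r2] := sqrt2_bounds R.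
have TE i : T i = ((a i)%:R + T i.+1)^-1 by have [] := HT i.
have [c c4 cI] : exists2 c, cf_digit c & 2 * cf_min R <= lambda - c%:R <= 2 * cf_max R.
  rewrite /cf_min /cf_max; have [h1|h1] := leP lambda (5 / 2).
    by exists 1 => //; apply/andP; split; lra.
  have [h2|h2] := leP lambda (7 / 2); first by exists 2 => //; apply/andP; split; lra.
  have [h3|h3] := leP lambda (9 / 2); first by exists 3 => //; apply/andP; split; lra.
  by exists 4 => //; apply/andP; split; lra.
have [w1 [w2 [w14 w24 W]]] := cf_eval_sum_dense cI delta0.
(* Seen from the central digit [c], [w1] is read forwards and [w2] backwards; the parity of [i] is
   corrected by the length of [w2]. *)
have [|i [i0 ib iE]] := aw (rev w2 ++ c :: w1) (b (+) odd (size w2)).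
  by rewrite all_cat all_rev w24 /= c4 w14.
exists (i + size w2)%N; split; first by rewrite oddD ib -addbA addbb addbF.
have -> : cf_rev R a (i + size w2) = cf_eval w2 (cf_rev R a i).
  apply: cf_eval_rev => // j jw; rewrite iE ?nth_cat ?size_rev ?jw //.
  by rewrite size_cat size_rev ltn_addr.
have -> : (T (i + size w2)%N)^-1 = c%:R + cf_eval w1 (T ((i + size w2).+1 + size w1)%N).
  rewrite TE invrK; congr (_%:R + _).
    rewrite iE; first by rewrite nth_cat size_rev ltnn subnn.
    by rewrite size_cat size_rev /= addnS ltnS leq_addr.
  apply: (cf_eval_tail TE) => j jw; rewrite -addnS -addnA iE.
    by rewrite nth_cat size_rev ltnNge addSnnS leq_addr /= addKn.
  by rewrite size_cat size_rev /= addSnnS ltn_add2l.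
have vI : in_cf_range (cf_rev R a i).
  by case: i i0 {ib iE} => // i _; exact: cf_rev_range.
have [TI _] := HT ((i + size w2).+1 + size w1)%N.
have := W _ _ TI vI; rewrite (_ : _ - _ = c%:R + cf_eval w1 (T ((i + size w2).+1 + size w1)%N) +
  cf_eval w2 (cf_rev R a i) - lambda) //; ring.
Qed.

(** * The set of accumulation points *)

Theorem theorem11 (R : realType) :
  exists alpha : R, irrational alpha /\
    let eps : R := Num.sqrt 2 / 8 in
    accS alpha = `]-oo, - eps]%classic `|` `[eps, +oo[%classic.
Proof.
pose a := universal_digit.
have a4 i : cf_digit (a i) := universal_digit_digit i.
have a0 : (1 < a 0)%N by [].
have [T HT] := cf_tails_exist R a4.
have TE i : T i = ((a i)%:R + T i.+1)^-1 by have [] := HT i.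
have T01 i : 0 < T i <= 1.
  by have [/cf_range_ge/andP[? ?] _] := HT i; apply/andP; split; lra.
have T0 i : 0 < T i by have /andP[] := T01 i.
have /andP[r1 r2] := sqrt2_bounds R; have r3 := sqrt2_sqr R.
pose eps : R := Num.sqrt 2 / 8.
have eps0 : 0 < eps by rewrite /eps; lra.
have scaledE (k m : int) : m != 0 ->
    m%:~R ^+ 2 * (k%:~R / m%:~R - T 0) = - (m%:~R * (m%:~R * T 0 - k%:~R)) :> R.
  by move=> m0; field; rewrite intr_eq0.
have low (k m : int) : m != 0 -> eps <= `|m%:~R * (m%:~R * T 0 - k%:~R)|.
  move=> m0; have [n] := cf_error_best k m a4 a0 TE T01 m0; apply: le_trans.
  have /andP[l1 l2] := cf_value_range n a4 a0 HT.
  rewrite (cf_error_value n a4 a0 TE T0) normrM normr_sign mul1r.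
  rewrite ger0_norm ?invr_ge0; last lra.
  rewrite -[X in _ <= X]div1r ler_pdivlMr; last lra.
  by rewrite /eps; nra.
have dense (x delta : R) : eps <= `|x| -> 0 < delta ->
    exists2 y, scaled_errors (T 0) y & `|y - x| <= delta.
  move=> xe delta0.
  have x0 : 0 < `|x| by lra.
  (* The least such [N] is [r.+2], since [eps <= |x|]. Then [rr = r + 1] satisfies [rr ^+ 2 * eps <=
     |x| <= 4 * rr ^+ 2 * eps]. *)
  have : exists N, `|x| < N%:R ^+ 2 * eps.
    have [N hN] : exists N : nat, `|x| / eps < N%:R.
      by exists (Num.bound (`|x| / eps)); apply: archi_boundP; apply: divr_ge0; lra.
    exists N.+1; rewrite -ltr_pdivrMr //; apply: lt_le_trans hN _.
    by rewrite -natrX ler_nat expnS expn1; nia.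
  move=> /ex_minnP [N xN Nmin].
  case: N xN Nmin => [|[|r]]; rewrite ?expr0n ?expr1n /=; [lra|lra|].
  move=> xN /(_ r.+1) Nmin.
  have {}Nmin : r.+1%:R ^+ 2 * eps <= `|x|.
    by rewrite leNgt; apply/negP => /Nmin; rewrite ltnn.
  set rr : R := r.+1%:R in Nmin.
  have rr1 : 1 <= rr by rewrite /rr ler1n.
  have xr : `|x| <= 4 * rr ^+ 2 * eps.
    have rrS : r.+2%:R = rr + 1 by rewrite /rr -[LHS]natr1.
    by apply: (le_trans (ltW xN)); rewrite rrS ler_pM2r //; nra.
  pose lambda := rr ^+ 2 / `|x|.
  have rr0 : 0 < rr ^+ 2 by rewrite exprn_gt0 //; lra.
  have [l1 l2] : Num.sqrt 2 <= lambda /\ lambda <= 4 * Num.sqrt 2.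
    rewrite /lambda ler_pdivlMr // ler_pdivrMr //.
    by move: Nmin xr; rewrite /eps; move: (rr ^+ 2) => u Nmin xr; split; nra.
  have lI : Num.sqrt 2 <= lambda <= 4 * Num.sqrt 2 by rewrite l1.
  (* The scaled error has sign [- (-1) ^+ n], so positive [x] needs odd [n]. The tolerance
     [delta / rr ^+ 2] works because [ln * lambda >= 1]. *)
  have [n [nb nl]] := cf_value_dense (0 < x) a4 a0
    (fun w b => universal_digit_word_parity b) HT lI (divr_gt0 delta0 rr0).
  have /andP[ln1 _] := cf_value_range n a4 a0 HT.
  set ln := _ + cf_rev R a n in nl ln1.
  have ln0 : 0 < ln by lra.
  have l0 : 0 < lambda by lra.
  have q0 := cf_den_gt0 n a4 a0.
  pose m : int := r.+1%:Z * cf_den a n.+1.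
  pose k : int := r.+1%:Z * cf_num a n.+1.
  have m0 : m != 0 by rewrite mulf_neq0 // lt0r_neq0.
  exists (m%:~R ^+ 2 * (k%:~R / m%:~R - T 0)); first by exists k, m.
  have -> : m%:~R ^+ 2 * (k%:~R / m%:~R - T 0) = - (-1) ^+ n * (rr ^+ 2 / ln).
    rewrite scaledE // mulNr [in RHS]mulrCA -(cf_error_value n a4 a0 TE T0) /cf_error.
    by rewrite /m /k !intrM -/rr; move: (cf_den a n.+1) (cf_num a n.+1) => q p; ring.
  have -> : x = - (-1) ^+ n * (rr ^+ 2 / lambda).
    have -> : rr ^+ 2 / lambda = `|x|.
      by rewrite /lambda invf_div mulrCA mulfV ?mulr1 // lt0r_neq0.
    rewrite -signr_odd nb; case: (ltP 0 x) => xs.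
      by rewrite gtr0_norm // expr1 opprK mul1r.
    by rewrite ler0_norm // expr0 mulN1r opprK.
  rewrite -mulrBr normrM normrN normr_sign mul1r.
  have -> : rr ^+ 2 / ln - rr ^+ 2 / lambda = rr ^+ 2 * ((lambda - ln) / (ln * lambda)).
    by field; rewrite !lt0r_neq0.
  rewrite normrM (gtr0_norm rr0) mulrC -ler_pdivlMr //; apply: le_trans nl.
  rewrite normrM distrC normfV ler_pdivrMr ?normr_gt0; last by rewrite mulf_neq0 ?lt0r_neq0.
  by rewrite ler_peMr // ger0_norm; nra.
exists (T 0); split.
  move=> /rationalP [k [m E]].
  (* A zero denominator would give [T 0 = 0]; otherwise the error vanishes, against [low]. *)
  have [m0|m0] := eqVneq m 0.
    by have := T0 0; rewrite E m0 invr0 mulr0 ltxx.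
  have mR : m%:R != 0 :> R by rewrite pnatr_eq0.
  have := low k m%:Z m0; rewrite E -pmulrn mulrC.
  by rewrite mulrCA mulfV // mulr1 subrr mul0r normr0 leNgt eps0.
move=> e; rewrite -/eps in e *.
have memE (x : R) : (`]-oo, - e] `|` `[e, +oo[)%classic x <-> e <= `|x|.
  rewrite /= !in_itv /= andbT ler_normr; split.
    by case=> h; apply/orP; [right|left]; lra.
  by case/orP => h; [right|left]; lra.
apply/seteqP; split => x; rewrite memE.
  move=> accx; rewrite leNgt; apply/negP => xe.
  have d0 : 0 < e - `|x| by rewrite subr_gt0.
  have [y [_ [k [m [m0 ->]]]]] := accx _ (nbhsx_ballx x _ d0).
  rewrite scaledE // -ball_normE /= => h.
  have := low k m m0; rewrite -normrN leNgt => /negP; apply.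
  have := ler_distD x (- (m%:~R * (m%:~R * T 0 - k%:~R))) 0.
  by rewrite !subr0 distrC; move: h; rewrite -/e; lra.
move=> xe U /nbhs_ballP [d /= d0 dU].
(* An accumulation point needs values other than [x]: the target is moved by [d / 2] away from 0 and
   approximated within [d / 4]. *)
have [x' [x'e xx']] : exists x', e <= `|x'| /\ `|x' - x| = d / 2.
  have [x0|x0] := leP 0 x.
    exists (x + d / 2); rewrite addrAC subrr add0r ger0_norm; last lra.
    by move: xe; rewrite ger0_norm // (ger0_norm (_ : 0 <= d / 2)); [split; lra|lra].
  exists (x - d / 2); rewrite addrAC subrr add0r ler0_norm; last lra.
  by move: xe; rewrite ltr0_norm // ler0_norm; [split; lra|lra].
have d4 : 0 < d / 4 by lra.
have [y Sy yx'] := dense x' (d / 4) x'e d4.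
exists y; split => //.
  by apply/eqP => yx; move: yx'; rewrite yx distrC xx'; lra.
apply: dU; rewrite -ball_normE /=.
by have := ler_distD x' x y; rewrite (distrC x x') xx' (distrC x' y); lra.
Qed.
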